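(* For every integer $n\ge 3$, the set $\{f(P(n),M): M\in\mathcal{M}_1(P(n))\}$ is continuous, i.e. it is an interval of integers: if $a<t<b$ are integers with $a,b$ in the set, then $t$ is in the set.
   Context: For $n\ge 3$, $P(n)=P(n,2)$ is the simple graph with vertex set $\{u_i,v_i:0\le i\le n-1\}$ and edge set $\{u_iu_{i+2},\,u_iv_i,\,v_iv_{i+1}:0\le i\le n-1\}$, subscripts modulo $n$. The edges $u_iv_i$ are called spokes. For a perfect matching $M$ of a graph $G$, a forcing set of $M$ is a subset $S\subseteq M$ contained in no perfect matching of $G$ other than $M$; the forcing number $f(G,M)$ is the minimum cardinality of a forcing set of $M$. For $n\neq 4$, $\mathcal{M}_1(P(n))$ is the set of perfect matchings $M$ of $P(n)$ such that either (i) $M$ contains at least one spoke, and for any two (cyclically) consecutive spokes $u_iv_i,u_jv_j$ of $M$ the number of spokes $u_kv_k$ of $P(n)$ strictly between them, $j-i-1$ (with $j$ taken as the representative in $(i,i+n]$), is $\equiv 0\pmod 4$ (if $M$ has exactly one spoke $u_iv_i$, it is regarded as two consecutive spokes with $j=i+n$, so the number is $n-1$); or (ii) $M$ contains no spoke, $4\mid n$, and for some $i$, $M=\bigcup_{k=0}^{n/4-1}\{u_{i+4k}u_{i+4k+2},\,u_{i+4k+1}u_{i+4k+3},\,v_{i+4k}v_{i+4k+1},\,v_{i+4k+2}v_{i+4k+3}\}$. For $n=4$, $\mathcal{M}_1(P(4))$ consists of the two perfect matchings $\{u_iv_i:0\le i\le 3\}$ and $\{u_0u_2,u_1u_3,v_0v_1,v_2v_3\}$.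 *)

(* Defs.v *)
From mathcomp Require Import all_boot all_order all_algebra.

Set Implicit Arguments.
Unset Strict Implicit.
Unset Printing Implicit Defensive.

(* A simple graph on [T] is given by its set of edges, each edge being the set
   of its two endpoints. *)
Section PerfectMatchings.
Variables (T : finType) (E : {set {set T}}).
Implicit Types M S : {set {set T}}.

Definition perfect_matching M : bool :=
  [&& M \subset E, trivIset M & cover M == [set: T]].

Definition forcing_set M S : bool :=
  (S \subset M) &&
  [forall M' : {set {set T}}, perfect_matching M' ==> (S \subset M') ==> (M' == M)].

(* The default candidate [M] is a forcing set of itself as soon as it is a
   perfect matching, see [forcing_setT]. *)
Definition forcing_number M : nat :=
  #|[arg min_(S < M | forcing_set M S) #|S|]|.

Lemma forcing_setT (nonempty_edges : set0 \notin E) M :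
  perfect_matching M -> forcing_set M M.
Proof.
case/and3P=> ME _ /eqP covM; rewrite /forcing_set subxx /=.
apply/forallP=> M'; apply/implyP=> /and3P[M'E tM' _]; apply/implyP=> sMM'.
rewrite eqEsubset sMM' andbT; apply/subsetP=> e eM'.
have /set0Pn[x xe] : e != set0.
  by apply: contraNneq nonempty_edges => <-; apply: (subsetP M'E).
have /bigcupP[d dM xd] : x \in cover M by rewrite covM inE.
have dM' := subsetP sMM' _ dM.
by rewrite -(def_pblock tM' eM' xe) (def_pblock tM' dM' xd).
Qed.

End PerfectMatchings.

(* ['Z_n] is the integers modulo [n] only for [1 < n]. *)
Definition vertex (n : nat) : finType := ('Z_n + 'Z_n)%type.

Section GeneralizedPetersen.
Variable n : nat.

(* Subscripts are natural numbers read modulo [n]. *)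
Definition u (k : nat) : vertex n := inl (inZp k).
Definition v (k : nat) : vertex n := inr (inZp k).

Definition uu (k : nat) : {set vertex n} := [set u k; u (k + 2)].
Definition spoke (k : nat) : {set vertex n} := [set u k; v k].
Definition vv (k : nat) : {set vertex n} := [set v k; v (k + 1)].

Definition P_edges : {set {set vertex n}} :=
  [set uu i | i : 'I_n] :|: [set spoke i | i : 'I_n] :|: [set vv i | i : 'I_n].

Implicit Type M : {set {set vertex n}}.

(* [j] ranges over representatives in (i, i + n], so the case [j = i + n] is
   that of a single spoke, seen as two consecutive ones. *)
Definition consecutive_spokes M (i j : nat) : Prop :=
  [/\ (i < n)%N, (i < j <= i + n)%N, spoke i \in M, spoke j \in M
    & forall k : nat, (i < k < j)%N -> spoke k \notin M].

Definition M1_spokes M : Prop :=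
  (exists i : 'I_n, spoke i \in M) /\
  (forall i j : nat, consecutive_spokes M i j -> j - i - 1 = 0 %[mod 4]).

Definition M1_no_spoke M : Prop :=
  [/\ forall i : 'I_n, spoke i \notin M,
      4 %| n
    & exists i : 'I_n, M = \bigcup_(k < n %/ 4)
        [set uu (i + 4 * k); uu (i + 4 * k + 1);
             vv (i + 4 * k); vv (i + 4 * k + 2)]].

Definition M1 M : Prop :=
  if n == 4 then
    M = [set spoke i | i : 'I_n] \/ M = [set uu 0; uu 1; vv 0; vv 2]
  else
    perfect_matching P_edges M /\ (M1_spokes M \/ M1_no_spoke M).

Definition M1_forcing_values (t : nat) : Prop :=
  exists M, M1 M /\ forcing_number P_edges M = t.

End GeneralizedPetersen.

Definition continuous_set (A : nat -> Prop) : Prop :=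
  forall a t b : nat, A a -> A b -> a < t < b -> A t.

(* Main.v *)
Require Import Defs.
From mathcomp Require Import all_boot all_order all_algebra.
From mathcomp Require Import zify.

(* A matching of the first kind is a circular tiling of the indices by single
   spokes and by "zigzags" of four indices, a zigzag at p consisting of
   u_p u_{p+2}, u_{p+1} u_{p+3}, v_p v_{p+1}, v_{p+2} v_{p+3}. Replacing a
   zigzag at p that is followed by a spoke by four spokes changes the forcing
   number by at most one: the two spokes at p and p + 4 force the spokes in
   between, and u_{p+1} u_{p+3} together with the spoke at p + 4 forces the
   zigzag, so in both directions a forcing set loses at least one edge and gains
   two. Iterating, every matching with a spoke is joined to the matching Z of all
   spokes by steps of size at most one. If there is no spoke then n = 4m, and
   counting the m disjoint blocks gives m <= f(M) <= m + 1 while f(Z) = m. Hence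
   all the integers between f(M) and f(Z) are values, for every M. *)

Set Implicit Arguments.
Unset Strict Implicit.
Unset Printing Implicit Defensive.

(** * Exchanging edges in perfect matchings of an arbitrary graph *)

Section Swap.
Variables (T : finType) (E : {set {set T}}).
Hypothesis nonempty_edges : set0 \notin E.
Implicit Types M N S F X : {set {set T}}.

(** The edges of [M] are pairwise disjoint, so [e] is the only one that can cover [x]. *)
Lemma sub_coverE M F e x : trivIset M -> F \subset M -> e \in M -> x \in e ->
  (x \in cover F) = (e \in F).
Proof.
move=> tM FM eM xe; apply/idP/idP => [/bigcupP[d dF xd]|eF]; last first.
  by apply/bigcupP; exists e.
by rewrite -(def_pblock tM eM xe) (def_pblock tM (subsetP FM _ dF) xd).
Qed.

Lemma perfect_matching_edge M e : perfect_matching E M -> e \in M ->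
  exists x, x \in e.
Proof.
case/and3P=> ME _ _ eM; apply/set0Pn.
by apply: contraNneq nonempty_edges => <-; apply: (subsetP ME).
Qed.

(** An edge common to [F'] and [M] has a vertex covered by [F], hence is the edge of [F] at that
    vertex, against disjointness. *)
Lemma cover_eq_disjoint M F F' : perfect_matching E M -> F \subset M ->
  cover F' = cover F -> [disjoint F & F'] -> [disjoint F' & M].
Proof.
move=> pM FM cF dF; have /and3P[_ tM _] := pM.
rewrite disjoint_subset; apply/subsetP=> e eF'; rewrite inE; apply/negP => eM.
have [x xe] := perfect_matching_edge pM eM.
have : x \in cover F' by apply/bigcupP; exists e.
rewrite cF (sub_coverE tM FM eM xe) => eF.
by have := disjointFr dF eF; rewrite eF'.
Qed.

Lemma perfect_matching_swap M F F' : perfect_matching E M -> F \subset M ->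
  F' \subset E -> trivIset F' -> cover F' = cover F ->
  perfect_matching E ((M :\: F) :|: F').
Proof.
case/and3P=> ME tM /eqP cM FM F'E tF' cF.
have coverMD : cover (M :\: F) = ~: cover F.
  apply/setP=> x; have := in_setT x; rewrite -cM => /bigcupP[e eM xe].
  by rewrite inE (sub_coverE tM FM eM xe) (sub_coverE tM (subsetDl _ _) eM xe)
       inE eM andbT.
apply/and3P; split.
- by rewrite subUset F'E andbT (subset_trans (subsetDl _ _)).
- apply: trivIsetU => //; first exact: (trivIsetS (subsetDl _ _) tM).
  by rewrite coverMD cF -setI_eq0 setIC setICr.
- by rewrite /cover bigcup_setU -/(cover _) -/(cover _) coverMD cF setUC setUCr.
Qed.

Lemma forcing_numberP M : perfect_matching E M ->
  exists2 S, forcing_set E M S & #|S| = forcing_number E M.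
Proof.
move=> pM; rewrite /forcing_number; case: arg_minnP => [|S fS _].
  exact: forcing_setT.
by exists S.
Qed.

Lemma forcing_setP M S : reflect
  (S \subset M /\ forall N, perfect_matching E N -> S \subset N -> N = M)
  (forcing_set E M S).
Proof.
apply: (iffP andP) => -[SM fS]; split=> //.
  by move=> N pN SN; have /forallP/(_ N) := fS; rewrite pN SN => /eqP.
by apply/forallP=> N; apply/implyP=> pN; apply/implyP=> SN; rewrite (fS N).
Qed.

Lemma forcing_number_le M S : forcing_set E M S ->
  forcing_number E M <= #|S|.
Proof.
move=> fS; rewrite /forcing_number; case: arg_minnP => [|S' _]; last exact.
have /forcing_setP[SM fSM] := fS; apply/forcing_setP; split=> // N pN MN.
exact: fSM pN (subset_trans SM MN).
Qed.

Lemma perfect_matching_sub M N : perfect_matching E M ->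
  perfect_matching E N -> M \subset N -> N = M.
Proof. by move=> /(forcing_setT nonempty_edges)/forcing_setP[_]; apply. Qed.

Lemma perfect_matching_covered F N : perfect_matching E N ->
  F \subset N -> cover F = [set: T] -> N = F.
Proof.
move=> pN FN cF; apply/eqP; rewrite eqEsubset FN andbT; apply/subsetP=> e eN.
have [x xe] := perfect_matching_edge pN eN; have /and3P[_ tN _] := pN.
by rewrite -(sub_coverE tN FN eN xe) cF inE.
Qed.

Section Flip.
Variables M F F' : {set {set T}}.
Hypotheses (pM : perfect_matching E M) (FM : F \subset M).
Hypotheses (F'E : F' \subset E) (tF' : trivIset F') (cF : cover F' = cover F).
Hypotheses (dF : [disjoint F & F']) (F'0 : F' != set0).

(** If [S] avoided [F], exchanging [F] for [F'] would give a second perfect matching containing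
    [S]. *)
Lemma forcing_set_meets S : forcing_set E M S -> S :&: F != set0.
Proof.
case/forcing_setP=> SM fS; apply: contraNneq F'0 => SF0.
have eM : (M :\: F) :|: F' = M.
  apply: fS; first exact: perfect_matching_swap.
  by rewrite subsetU // subsetD SM -setI_eq0 SF0 eqxx.
have := cover_eq_disjoint pM FM cF dF.
rewrite -setI_eq0; suff /setIidPl -> : F' \subset M by [].
by rewrite -eM subsetUr.
Qed.

(** Take a minimum forcing set [S] of [M]; then [(S :\: F) :|: X] forces the flipped matching.
    Indeed [X] forces [F'], and exchanging [F'] back for [F] gives a perfect matching containing
    [S], which must be [M]. The inequality is strict because [S] loses an edge of [F]. *)
Lemma forcing_number_flip X : X \subset (M :\: F) :|: F' ->
  (forall N, perfect_matching E N -> X \subset N -> F' \subset N) ->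
  forcing_number E ((M :\: F) :|: F') < forcing_number E M + #|X|.
Proof.
move=> XM' forceF'; have [S fS <-] := forcing_numberP pM.
have SF0 := forcing_set_meets fS; have /forcing_setP[SM fSM] := fS.
have pM' : perfect_matching E ((M :\: F) :|: F') by exact: perfect_matching_swap.
have tF : trivIset F by case/and3P: pM => _ tM _; apply: trivIsetS tM.
have FE : F \subset E by case/and3P: pM => ME _ _; apply: subset_trans ME.
have dF' : [disjoint F' & F] by rewrite disjoint_sym.
apply: leq_ltn_trans (forcing_number_le (S := (S :\: F) :|: X) _) _.
  apply/forcing_setP; split.
    by rewrite subUset XM' subsetU // setSD.
  move=> N pN; rewrite subUset => /andP[SN /(forceF' N pN) F'N].
  have dFN : [disjoint F & N] by apply: cover_eq_disjoint dF'.
  have F'M : [disjoint F' & M] by apply: cover_eq_disjoint cF dF.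
  have eM : (N :\: F') :|: F = M.
    apply: fSM; first exact: perfect_matching_swap.
    apply/subsetP=> e eS; rewrite !inE; have [_|eF] := boolP (e \in F); first exact: orbT.
    rewrite orbF (subsetP SN) ?inE ?eF // andbT.
    by apply/negP=> /(disjointFr F'M); rewrite (subsetP SM).
  rewrite -eM; apply/setP=> e; rewrite !inE.
  have := @disjointFr _ _ _ e dFN; have := @disjointFr _ _ _ e dF'.
  have := subsetP F'N e.
  by case: (e \in F); case: (e \in F'); case: (e \in N) => //= a b c;
    try (by have := a isT); try (by have := b isT); by have := c isT.
rewrite (leq_ltn_trans (leq_card_setU _ _)) // ltn_add2r -(cardsID F S).
by rewrite -[X in X < _]add0n ltn_add2r card_gt0.
Qed.

End Flip.

(** A forcing set contains a representative of each [F k], and disjointness makes these distinct. *)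
Lemma forcing_number_ge M m (F : 'I_m -> {set {set T}}) :
  perfect_matching E M ->
  (forall S k, forcing_set E M S -> S :&: F k != set0) ->
  (forall k l, k != l -> [disjoint F k & F l]) ->
  m <= forcing_number E M.
Proof.
move=> pM meetF dF; have [S fS <-] := forcing_numberP pM.
(* The default [set0] is never taken, since [S] meets every [F k]. *)
pose g k := odflt set0 [pick e in S :&: F k].
have gP k : g k \in S :&: F k.
  rewrite /g; case: pickP => [e //|] H; have /set0Pn[e] := meetF S k fS.
  by rewrite H.
have g_inj : injective g.
  move=> k l egkl; apply/eqP; apply: contraT => /dF/disjointFr kl.
  have /setIP[_ /kl] := gP k.
  by rewrite egkl; have /setIP[_ ->] := gP l.
rewrite -[m]card_ord -cardsT -(card_imset _ g_inj); apply/subset_leq_card.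
by apply/subsetP=> _ /imsetP[k _ ->]; have /setIP[] := gP k.
Qed.

End Swap.

(** * Incidences in P(n) and the edges of a perfect matching at a vertex *)

Section Incidence.
Variable n : nat.
Hypothesis n_gt2 : 2 < n.
Implicit Types (k l p : nat) (M N : {set {set vertex n}}).

Lemma eq_inZp k l : (inZp k == inZp l :> 'Z_n) = (k == l %[mod n]).
Proof. by rewrite -val_eqE /= Zp_cast // (leq_trans _ n_gt2). Qed.

Lemma u_in_uu k l :
  (u n k \in uu n l) = (k == l %[mod n]) || (k == l + 2 %[mod n]).
Proof. by rewrite !inE /= -!eq_inZp. Qed.

Lemma v_in_vv k l :
  (v n k \in vv n l) = (k == l %[mod n]) || (k == l + 1 %[mod n]).
Proof. by rewrite !inE /= -!eq_inZp. Qed.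

Lemma u_in_spoke k l : (u n k \in spoke n l) = (k == l %[mod n]).
Proof. by rewrite !inE /= -!eq_inZp orbF. Qed.

Lemma v_in_spoke k l : (v n k \in spoke n l) = (k == l %[mod n]).
Proof. by rewrite !inE /= -!eq_inZp. Qed.

Lemma v_in_uu k l : (v n k \in uu n l) = false.
Proof. by rewrite !inE. Qed.

Lemma u_in_vv k l : (u n k \in vv n l) = false.
Proof. by rewrite !inE. Qed.

Lemma u_mod k l : k = l %[mod n] -> u n k = u n l.
Proof. by move=> /eqP; rewrite -eq_inZp => /eqP kl; rewrite /u kl. Qed.

Lemma v_mod k l : k = l %[mod n] -> v n k = v n l.
Proof. by move=> /eqP; rewrite -eq_inZp => /eqP kl; rewrite /v kl. Qed.

Lemma mod_add k l c : k = l %[mod n] -> k + c = l + c %[mod n].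
Proof. by move=> /eqP kl; apply/eqP; rewrite eqn_modDr. Qed.

Lemma uu_mod k l : k = l %[mod n] -> uu n k = uu n l.
Proof. by move=> kl; rewrite /uu (u_mod kl) (u_mod (mod_add 2 kl)). Qed.

Lemma spoke_mod k l : k = l %[mod n] -> spoke n k = spoke n l.
Proof. by move=> kl; rewrite /spoke (u_mod kl) (v_mod kl). Qed.

Lemma vv_mod k l : k = l %[mod n] -> vv n k = vv n l.
Proof. by move=> kl; rewrite /vv (v_mod kl) (v_mod (mod_add 1 kl)). Qed.

Lemma ord_mod k : exists i : 'I_n, i = k %[mod n].
Proof.
have lt : k %% n < n by rewrite ltn_mod (leq_trans _ n_gt2).
by exists (Ordinal lt); rewrite /= modn_mod.
Qed.

Lemma uu_edge k : uu n k \in P_edges n.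
Proof.
have [i ik] := ord_mod k; rewrite !inE -(uu_mod ik).
by rewrite (imset_f (fun j : 'I_n => uu n j)).
Qed.

Lemma spoke_edge k : spoke n k \in P_edges n.
Proof.
have [i ik] := ord_mod k; rewrite !inE -(spoke_mod ik).
by rewrite (imset_f (fun j : 'I_n => spoke n j)) ?orbT.
Qed.

Lemma vv_edge k : vv n k \in P_edges n.
Proof.
have [i ik] := ord_mod k; rewrite !inE -(vv_mod ik).
by rewrite (imset_f (fun j : 'I_n => vv n j)) ?orbT.
Qed.

Lemma P_edges_nonempty : set0 \notin P_edges n.
Proof.
apply/negP; rewrite !inE => /orP[/orP[]|] /imsetP[i _ /setP].
- by move/(_ (u n i)); rewrite u_in_uu eqxx inE.
- by move/(_ (u n i)); rewrite u_in_spoke eqxx inE.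
- by move/(_ (v n i)); rewrite v_in_vv eqxx inE.
Qed.

Lemma uu_neq_spoke k l : uu n k <> spoke n l.
Proof. by move/setP/(_ (v n l)); rewrite v_in_uu v_in_spoke eqxx. Qed.

Lemma vv_neq_spoke k l : vv n k <> spoke n l.
Proof. by move/setP/(_ (u n l)); rewrite u_in_vv u_in_spoke eqxx. Qed.

Lemma spoke_inj k l : spoke n k = spoke n l -> k = l %[mod n].
Proof. by move/setP/(_ (u n k)); rewrite !u_in_spoke eqxx => /esym/eqP. Qed.

Lemma eqn_mod_addr k c : (k == k + c %[mod n]) = (n %| c).
Proof. by rewrite -[in X in X == _](addn0 k) eqn_modDl mod0n eq_sym. Qed.

Lemma not_dvd_small c : 0 < c < n -> (n %| c) = false.
Proof. by case/andP=> c0 ltcn; rewrite gtnNdvd. Qed.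

Lemma vv_neq_succ k : vv n k <> vv n (k + 1).
Proof.
move/setP/(_ (v n k)); rewrite !v_in_vv eqxx /= -addnA !eqn_mod_addr.
by rewrite !not_dvd_small ?(ltnW n_gt2).
Qed.

Section PerfectMatching.
Variable N : {set {set vertex n}}.
Hypothesis pN : perfect_matching (P_edges n) N.

Lemma matching_edge_unique w e f :
  e \in N -> f \in N -> w \in e -> w \in f -> e = f.
Proof.
case/and3P: pN => _ tN _ eN fN we wf.
by rewrite -(def_pblock tN eN we) (def_pblock tN fN wf).
Qed.

(** These are the three edges at [u n (k + 2)]; the shift by 2 avoids subtracting from an index.
    Likewise [v_cover] concerns [v n (k + 1)]. *)
Lemma u_cover k :
  [|| uu n k \in N, uu n (k + 2) \in N | spoke n (k + 2) \in N].
Proof.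
case/and3P: pN => NE _ /eqP cN.
have /bigcupP[e eN ue] : u n (k + 2) \in cover N by rewrite cN inE.
have := subsetP NE e eN; rewrite !inE => /orP[/orP[]|] /imsetP[i _ de];
  move: eN ue; rewrite {e}de.
- move=> iN; rewrite u_in_uu eqn_modDr => /orP[] /eqP /uu_mod ->;
    by rewrite iN ?orbT.
- by move=> iN; rewrite u_in_spoke => /eqP/spoke_mod ->; rewrite iN !orbT.
- by rewrite u_in_vv.
Qed.

Lemma v_cover k :
  [|| vv n k \in N, vv n (k + 1) \in N | spoke n (k + 1) \in N].
Proof.
case/and3P: pN => NE _ /eqP cN.
have /bigcupP[e eN ve] : v n (k + 1) \in cover N by rewrite cN inE.
have := subsetP NE e eN; rewrite !inE => /orP[/orP[]|] /imsetP[i _ de];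
  move: eN ve; rewrite {e}de.
- by rewrite v_in_uu.
- by move=> iN; rewrite v_in_spoke => /eqP/spoke_mod ->; rewrite iN !orbT.
- move=> iN; rewrite v_in_vv eqn_modDr => /orP[] /eqP /vv_mod ->;
    by rewrite iN ?orbT.
Qed.

Lemma spoke_uu k : spoke n k \in N -> uu n k \notin N.
Proof.
move=> sN; apply/negP => uN; apply: (@uu_neq_spoke k k).
by apply: (matching_edge_unique (w := u n k)); rewrite // ?u_in_uu ?u_in_spoke eqxx.
Qed.

Lemma spoke_uu2 k : spoke n (k + 2) \in N -> uu n k \notin N.
Proof.
move=> sN; apply/negP => uN; apply: (@uu_neq_spoke k (k + 2)).
by apply: (matching_edge_unique (w := u n (k + 2)));
  rewrite // ?u_in_uu ?u_in_spoke eqxx ?orbT.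
Qed.

Lemma spoke_vv k : spoke n k \in N -> vv n k \notin N.
Proof.
move=> sN; apply/negP => vN; apply: (@vv_neq_spoke k k).
by apply: (matching_edge_unique (w := v n k)); rewrite // ?v_in_vv ?v_in_spoke eqxx.
Qed.

Lemma spoke_vv1 k : spoke n (k + 1) \in N -> vv n k \notin N.
Proof.
move=> sN; apply/negP => vN; apply: (@vv_neq_spoke k (k + 1)).
by apply: (matching_edge_unique (w := v n (k + 1)));
  rewrite // ?v_in_vv ?v_in_spoke eqxx ?orbT.
Qed.

Lemma vv_vv k : vv n k \in N -> vv n (k + 1) \notin N.
Proof.
move=> vN; apply/negP => v1N; apply: (@vv_neq_succ k).
by apply: (matching_edge_unique (w := v n (k + 1)));
  rewrite // v_in_vv eqxx ?orbT.
Qed.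

(** The two edges share [u n (k + 2)], so they would have to be equal, which forces [n] to divide 4.
    At [n = 4] they are indeed the same edge. *)
Lemma uu_uu (n4 : n != 4) k : uu n k \in N -> uu n (k + 2) \notin N.
Proof.
move=> uN; apply/negP => u2N.
have /setP/(_ (u n k)) : uu n k = uu n (k + 2).
  by apply: (matching_edge_unique (w := u n (k + 2)));
    rewrite // u_in_uu eqxx ?orbT.
rewrite !u_in_uu eqxx /= -addnA !eqn_mod_addr not_dvd_small //= => /esym n_dvd4.
have := dvdn_leq (isT : 0 < 4) n_dvd4.
by move: n_gt2 n4 n_dvd4; case: n => [|[|[|[|[|m]]]]].
Qed.

Lemma spokes_all : (forall k, spoke n k \in N) -> N = [set spoke n i | i : 'I_n].
Proof.
move=> sN; apply/eqP; rewrite eqEsubset; apply/andP; split; last first.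
  by apply/subsetP=> _ /imsetP[i _ ->].
case/and3P: pN => NE _ _; apply/subsetP=> e eN.
have := subsetP NE e eN; rewrite !inE => /orP[/orP[]|] // /imsetP[i _ de].
- by have := spoke_uu (sN i); rewrite -de eN.
- by have := spoke_vv (sN i); rewrite -de eN.
Qed.

End PerfectMatching.
End Incidence.

(** * Blocks of four indices: spokes against zigzags *)

Definition spokes4 n p : {set {set vertex n}} :=
  [set spoke n p; spoke n (p + 1); spoke n (p + 2); spoke n (p + 3)].

Definition zigzag n p : {set {set vertex n}} :=
  [set uu n p; uu n (p + 1); vv n p; vv n (p + 2)].

Section Blocks.
Variable n : nat.
Hypothesis n_gt2 : 2 < n.
Implicit Types (k l p : nat) (M N : {set {set vertex n}}).

Lemma spokes4_sub N p : (spokes4 n p \subset N) =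
  [&& spoke n p \in N, spoke n (p + 1) \in N, spoke n (p + 2) \in N
    & spoke n (p + 3) \in N].
Proof. by rewrite !subUset !sub1set -!andbA. Qed.

Lemma zigzag_sub N p : (zigzag n p \subset N) =
  [&& uu n p \in N, uu n (p + 1) \in N, vv n p \in N & vv n (p + 2) \in N].
Proof. by rewrite !subUset !sub1set -!andbA. Qed.

Lemma spokes4_edges p : spokes4 n p \subset P_edges n.
Proof. by rewrite spokes4_sub !spoke_edge. Qed.

(** Both blocks cover the [u] and [v] vertices of indices [p] to [p + 3]; this is what makes them
    exchangeable. *)
Lemma cover_zigzag p : cover (zigzag n p) = cover (spokes4 n p).
Proof.
rewrite /cover /zigzag /spokes4 !bigcup_setU !big_set1 /uu /vv /spoke -!addnA.
by apply/setP=> w; rewrite !inE -!orbA;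
  case: (w == u n p); case: (w == u n (p + 1)); case: (w == u n (p + 2));
  case: (w == u n (p + 3)); rewrite ?orbT //= ?orbF.
Qed.

Lemma disjoint_spokes M p : (forall e, e \in M -> exists k, e = spoke n k) ->
  [disjoint M & zigzag n p].
Proof.
move=> sM; rewrite disjoint_subset; apply/subsetP=> e /sM[k ->].
rewrite !inE !negb_or -!andbA; apply/and4P.
by split; apply/eqP => /esym; [apply: uu_neq_spoke|apply: uu_neq_spoke|
  apply: vv_neq_spoke|apply: vv_neq_spoke].
Qed.

Lemma disjoint_zigzag_spokes4 p : [disjoint zigzag n p & spokes4 n p].
Proof.
rewrite disjoint_sym disjoint_spokes // => e.
by rewrite !inE -!orbA => /or4P[] /eqP ->; eexists.
Qed.

Lemma spokes4_neq0 p : spokes4 n p != set0.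
Proof. by apply/set0Pn; exists (spoke n p); rewrite !inE eqxx. Qed.

Lemma zigzag_neq0 p : zigzag n p != set0.
Proof. by apply/set0Pn; exists (uu n p); rewrite !inE eqxx. Qed.

Section LocalForcing.
Variable N : {set {set vertex n}}.
Hypothesis pN : perfect_matching (P_edges n) N.

(** The outer spokes exclude both [uu] edges at index [p + 2], leaving its spoke. The three spokes
    then exclude all [vv] edges at [p + 1] and [p + 3]. *)
Lemma spokes4_forced p : spoke n p \in N -> spoke n (p + 4) \in N ->
  spokes4 n p \subset N.
Proof.
move=> s0 s4; rewrite spokes4_sub s0 /=.
have s2 : spoke n (p + 2) \in N.
  have := u_cover n_gt2 pN p; rewrite (negPf (spoke_uu n_gt2 pN s0)) /=.
  by rewrite (negPf (spoke_uu2 n_gt2 pN _)) //= -addnA.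
have y0 := spoke_vv n_gt2 pN s0; have y2 := spoke_vv n_gt2 pN s2.
have y1 : vv n (p + 1) \notin N by rewrite (spoke_vv1 n_gt2 pN) // -addnA.
have y3 : vv n (p + 3) \notin N by rewrite (spoke_vv1 n_gt2 pN) // -addnA.
have := v_cover n_gt2 pN p; rewrite (negPf y0) (negPf y1) /= => ->.
have := v_cover n_gt2 pN (p + 2); rewrite -addnA (negPf y2) (negPf y3) /= => ->.
by rewrite s2.
Qed.

(** The hypotheses exclude [vv n (p + 3)] and the spoke at [p + 3], so [vv n (p + 2)] is forced;
    then [v n (p + 1)] can only use [vv n p], and [u n (p + 2)] only [uu n p]. *)
Lemma zigzag_forced p : n != 4 -> uu n (p + 1) \in N ->
  spoke n (p + 4) \in N -> zigzag n p \subset N.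
Proof.
move=> n4 x1 s4; rewrite zigzag_sub x1 /=.
have x2 : uu n (p + 2) \notin N by rewrite (spoke_uu2 n_gt2 pN) // -addnA.
have y3 : vv n (p + 3) \notin N by rewrite (spoke_vv1 n_gt2 pN) // -addnA.
have s1 : spoke n (p + 1) \notin N by apply: contraL x1; apply: spoke_uu.
have s3 : spoke n (p + 3) \notin N.
  by apply: contraL x1 => s3; rewrite (spoke_uu2 n_gt2 pN) // -addnA.
have y2 : vv n (p + 2) \in N.
  have := v_cover n_gt2 pN (p + 2).
  by rewrite -addnA (negPf y3) (negPf s3) !orbF.
have s2 : spoke n (p + 2) \notin N by apply: contraL y2; apply: spoke_vv.
have y1 : vv n (p + 1) \notin N.
  apply: contraL y2 => y1; have := vv_vv n_gt2 pN y1.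
  by rewrite -addnA.
have := v_cover n_gt2 pN p; rewrite (negPf y1) (negPf s1) !orbF => ->.
have := u_cover n_gt2 pN p; rewrite (negPf x2) (negPf s2) !orbF => ->.
by rewrite y2.
Qed.

(** One step of a propagation around the cycle: besides completing the zigzag at [p], it yields the
    two [uu] edges that start the next zigzag. *)
Lemma zigzag_chain p : n != 4 -> uu n p \in N -> uu n (p + 1) \in N ->
  vv n (p + 4) \in N ->
  [/\ zigzag n p \subset N, uu n (p + 4) \in N & uu n (p + 5) \in N].
Proof.
move=> n4 x0 x1 y4.
have x2 := uu_uu n_gt2 pN n4 x0.
have x3 : uu n (p + 3) \notin N by have := uu_uu n_gt2 pN n4 x1; rewrite -addnA.
have s1 : spoke n (p + 1) \notin N by apply: contraL x1; apply: spoke_uu.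
have s3 : spoke n (p + 3) \notin N.
  by apply: contraL x1 => s3; rewrite (spoke_uu2 n_gt2 pN) // -addnA.
have s4 : spoke n (p + 4) \notin N by apply: contraL y4; apply: spoke_vv.
have s5 : spoke n (p + 5) \notin N.
  by apply: contraL y4 => s5; rewrite (spoke_vv1 n_gt2 pN) // -addnA.
have y3 : vv n (p + 3) \notin N.
  by apply: contraL y4 => /(vv_vv n_gt2 pN); rewrite -addnA.
have y2 : vv n (p + 2) \in N.
  have := v_cover n_gt2 pN (p + 2).
  by rewrite -addnA (negPf y3) (negPf s3) !orbF.
have y1 : vv n (p + 1) \notin N.
  by apply: contraL y2 => /(vv_vv n_gt2 pN); rewrite -addnA.
split.
- rewrite zigzag_sub x0 x1 y2 andbT /=.
  by have := v_cover n_gt2 pN p; rewrite (negPf y1) (negPf s1) !orbF.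
- by have := u_cover n_gt2 pN (p + 2); rewrite -addnA (negPf x2) (negPf s4) orbF.
- by have := u_cover n_gt2 pN (p + 3); rewrite -addnA (negPf x3) (negPf s5) orbF.
Qed.

End LocalForcing.

Definition all_spokes : {set {set vertex n}} := [set spoke n i | i : 'I_n].

Lemma spoke_all_spokes k : spoke n k \in all_spokes.
Proof.
have [i ik] := ord_mod n_gt2 k; rewrite -(spoke_mod n_gt2 ik).
exact: (imset_f (fun j : 'I_n => spoke n j)).
Qed.

Lemma all_spokes_perfect : perfect_matching (P_edges n) all_spokes.
Proof.
apply/and3P; split.
- by apply/subsetP=> _ /imsetP[i _ ->]; apply: spoke_edge.
- apply/trivIsetP=> _ _ /imsetP[i _ ->] /imsetP[j _ ->]; apply: contraNT.
  rewrite -setI_eq0 => /set0Pn[w /setIP[]]; rewrite {1}/spoke !in_set2.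
  by move=> /orP[] /eqP ->; rewrite -in_set2 -/(spoke n j)
    ?u_in_spoke ?v_in_spoke // => /eqP/(spoke_mod n_gt2) ->.
apply/eqP/setP=> w; rewrite inE; apply/bigcupP.
case: w => a; exists (spoke n a); rewrite ?spoke_all_spokes //.
  by rewrite !inE /u valZpK eqxx.
by rewrite !inE /v valZpK eqxx orbT.
Qed.

Definition straighten M p := (M :\: zigzag n p) :|: spokes4 n p.

Section Straighten.
Variables (M : {set {set vertex n}}) (p : nat).
Hypotheses (n4 : n != 4) (pM : perfect_matching (P_edges n) M).
Hypotheses (zM : zigzag n p \subset M).

Let zigzag_trivIset : trivIset (zigzag n p).
Proof. by case/and3P: pM => _ tM _; apply: trivIsetS tM. Qed.

Let zigzag_edges : zigzag n p \subset P_edges n.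
Proof. by rewrite zigzag_sub !uu_edge ?vv_edge. Qed.

Let spokes4_trivIset : trivIset (spokes4 n p).
Proof.
case/and3P: all_spokes_perfect => _ tZ _; apply: trivIsetS tZ.
by rewrite spokes4_sub !spoke_all_spokes.
Qed.

Lemma straighten_perfect : perfect_matching (P_edges n) (straighten M p).
Proof.
apply: perfect_matching_swap => //; first exact: spokes4_edges.
by rewrite cover_zigzag.
Qed.

Lemma disjoint_spokes4 : [disjoint spokes4 n p & M].
Proof.
apply: (cover_eq_disjoint (P_edges_nonempty n_gt2) pM zM).
  by rewrite cover_zigzag.
exact: disjoint_zigzag_spokes4.
Qed.

Lemma straightenK : (straighten M p :\: spokes4 n p) :|: zigzag n p = M.
Proof.
rewrite /straighten; move: disjoint_spokes4 zM.
move: (spokes4 n p) (zigzag n p) => F' F /disjointFr dF /subsetP FM.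
apply/setP=> e; rewrite !inE; have := FM e; have := @dF e.
case: (e \in F); case: (e \in F'); case: (e \in M) => //=.
- by move=> _ /(_ isT).
- by move=> _ /(_ isT).
- by move=> /(_ isT).
Qed.

Lemma forcing_set_meets_zigzag S :
  forcing_set (P_edges n) M S -> S :&: zigzag n p != set0.
Proof.
apply: (forcing_set_meets (P_edges_nonempty n_gt2) pM zM (spokes4_edges p)) => //.
- by rewrite cover_zigzag.
- exact: disjoint_zigzag_spokes4.
- exact: spokes4_neq0.
Qed.

Lemma forcing_set_meets_spokes4 N S : perfect_matching (P_edges n) N ->
  spokes4 n p \subset N ->
  forcing_set (P_edges n) N S -> S :&: spokes4 n p != set0.
Proof.
move=> pN sN.
apply: (forcing_set_meets (P_edges_nonempty n_gt2) pN sN zigzag_edges) => //.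
- by rewrite cover_zigzag.
- by rewrite disjoint_sym disjoint_zigzag_spokes4.
- exact: zigzag_neq0.
Qed.

Hypothesis sM : spoke n (p + 4) \in M.

Lemma forcing_number_straighten_le :
  forcing_number (P_edges n) (straighten M p) <= (forcing_number (P_edges n) M).+1.
Proof.
(* The first spoke belongs to the new block, the second survives from [M]; together they force the
   block. *)
pose X := [set spoke n p; spoke n (p + 4)].
have spz k : spoke n k \notin zigzag n p.
  apply/negP; rewrite !inE -!orbA => /or4P[] /eqP /esym.
  + exact: uu_neq_spoke.
  + exact: uu_neq_spoke.
  + exact: vv_neq_spoke.
  + exact: vv_neq_spoke.
have lt : forcing_number (P_edges n) (straighten M p) <
    forcing_number (P_edges n) M + #|X|.
  apply: forcing_number_flip => //.
  - exact: P_edges_nonempty.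
  - exact: spokes4_edges.
  - by rewrite cover_zigzag.
  - exact: disjoint_zigzag_spokes4.
  - exact: spokes4_neq0.
  - rewrite subUset !sub1set !in_setU !in_setD !spz sM /= andbT.
    by rewrite !inE eqxx orbT.
  - move=> N pN; rewrite subUset !sub1set => /andP[]; exact: spokes4_forced.
by rewrite -ltnS (leq_trans lt) // -[(_).+2]addn2 leq_add2l cards2; case: (_ != _).
Qed.

Lemma forcing_number_straighten_ge :
  forcing_number (P_edges n) M <= (forcing_number (P_edges n) (straighten M p)).+1.
Proof.
pose X := [set uu n (p + 1); spoke n (p + 4)].
have s4 : spoke n (p + 4) \notin spokes4 n p.
  by apply/negP => /(disjointFr disjoint_spokes4); rewrite sM.
have lt : forcing_number (P_edges n) M <
    forcing_number (P_edges n) (straighten M p) + #|X|.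
  rewrite -[in X in X < _]straightenK; apply: forcing_number_flip => //.
  - exact: P_edges_nonempty.
  - exact: straighten_perfect.
  - exact: subsetUr.
  - by rewrite cover_zigzag.
  - by rewrite disjoint_sym disjoint_zigzag_spokes4.
  - exact: zigzag_neq0.
  - rewrite straightenK subUset !sub1set sM andbT.
    by move: zM; rewrite zigzag_sub => /and4P[].
  - move=> N pN; rewrite subUset !sub1set => /andP[]; exact: zigzag_forced.
by rewrite -ltnS (leq_trans lt) // -[(_).+2]addn2 leq_add2l cards2; case: (_ != _).
Qed.

(** The decreasing measure for the passage to the matching of all spokes: only spokes are added, and
    [uu n p] is lost. *)
Lemma card_straighten :
  #|straighten M p :\: all_spokes| < #|M :\: all_spokes|.
Proof.
have uM : uu n p \in M by move: zM; rewrite zigzag_sub => /and4P[].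
have uZ : uu n p \notin all_spokes.
  by apply/negP => /imsetP[i _]; apply: uu_neq_spoke.
apply/proper_card/properP; split; last first.
  exists (uu n p); rewrite !inE ?uZ //= eqxx /= !negb_or -!andbA.
  by apply/and4P; split; apply/eqP; apply: uu_neq_spoke.
apply/subsetP=> e /setDP[/setUP[/setDP[eM _]|es] eZ]; first exact/setDP.
by move: es; rewrite !inE -!orbA => es; case/negP: eZ; case/or4P: es => /eqP ->;
  apply: spoke_all_spokes.
Qed.

End Straighten.

End Blocks.

(* Cutting P(n) between the indices k and k + 1, the number of edges of a
   perfect matching across the cut has a parity independent of k. At a cut just
   before a spoke, only the edge u_k u_{k+2} can cross, and it does exactly in
   the odd case, where the gaps between spokes are 2 modulo 4. *)
Definition even_matching n (M : {set {set vertex n}}) :=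
  [/\ perfect_matching (P_edges n) M, exists k, spoke n k \in M
    & forall k, spoke n (k + 1) \in M -> uu n k \notin M].

(** * Even matchings are exactly the matchings of the first kind *)

Section EvenMatchings.
Variable n : nat.
Hypotheses (n_gt2 : 2 < n) (n4 : n != 4).
Implicit Types (k l p : nat) (M N : {set {set vertex n}}).

Lemma even_all_spokes : even_matching (all_spokes n).
Proof.
split; first exact: all_spokes_perfect.
  by exists 0; apply: spoke_all_spokes.
move=> k _; apply/negP => /imsetP[i _]; exact: uu_neq_spoke.
Qed.

Lemma even_straighten M p : even_matching M -> zigzag n p \subset M ->
  even_matching (straighten M p).
Proof.
case=> pM _ eM zM; have := zM; rewrite zigzag_sub => /and4P[x0 x1 _ _].
have uuM k : uu n k \in straighten M p -> uu n k \in M /\ uu n k \notin zigzag n p.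
  rewrite in_setU in_setD => /orP[/andP[-> ->] //|].
  by rewrite !inE -!orbA => /or4P[] /eqP/uu_neq_spoke.
split; first exact: straighten_perfect.
  by exists p; apply/setUP; right; rewrite !inE eqxx.
move=> k; rewrite in_setU => /orP[|sk].
  rewrite in_setD => /andP[_ /eM]; apply: contra.
  by case/uuM.
apply/negP => /uuM[xk]; apply/negP; rewrite negbK.
have {sk} : [|| k + 1 == p %[mod n], k + 1 == p + 1 %[mod n],
    k + 1 == p + 2 %[mod n] | k + 1 == p + 3 %[mod n]].
  by move: sk; rewrite !inE -!orbA => /or4P[] /eqP/(spoke_inj n_gt2) ->;
    rewrite eqxx ?orbT.
(* For a new spoke at [k + 1], the edge [uu n k] either was removed with the zigzag (at [p] or
   [p + 1]), or shares a vertex with one of the zigzag's [uu] edges. *)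
case/or4P=> /eqP kp.
- have : uu n (k + 2) \in M.
    by rewrite (uu_mod n_gt2 (l := p + 1)) //; have := mod_add 1 kp; rewrite -addnA.
  by rewrite (negPf (uu_uu n_gt2 pM n4 xk)).
- rewrite (uu_mod n_gt2 (l := p)) ?inE ?eqxx //.
  by apply/eqP; move/eqP: kp; rewrite eqn_modDr.
- rewrite (uu_mod n_gt2 (l := p + 1)) ?inE ?eqxx ?orbT //.
  by apply/eqP; move/eqP: kp; rewrite -[p + 2]/(p + (1 + 1)) addnA eqn_modDr.
- have : uu n (p + 2) \in M.
    rewrite -(uu_mod n_gt2 (k := k)) //.
    by apply/eqP; move/eqP: kp; rewrite -[p + 3]/(p + (2 + 1)) addnA eqn_modDr.
  by rewrite (negPf (uu_uu n_gt2 pM n4 x0)).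
Qed.

(** Some spoke at [k + 4] follows a missing spoke at [k + 3], since otherwise absence would
    propagate around the cycle. Evenness excludes [uu n (k + 3)], so [u n (k + 3)] is matched by
    [uu n (k + 1)], and this forces the zigzag. *)
Lemma even_zigzag M : even_matching M -> M <> all_spokes n ->
  exists p, zigzag n p \subset M /\ spoke n (p + 4) \in M.
Proof.
case=> pM [i0 si0] eM MZ.
have [/existsP[k /andP[s3 s4]]|/existsPn noz] := boolP
  [exists k : 'I_n, (spoke n (k + 3) \notin M) && (spoke n (k + 4) \in M)].
  exists k; split=> //; apply: zigzag_forced => //.
  have := eM (k + 3); rewrite -addnA => /(_ s4) x3.
  have := u_cover n_gt2 pM (k + 1).
  by rewrite -addnA (negPf x3) (negPf s3) !orbF.
case: MZ; apply: spokes_all => // k.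
have step l : spoke n (l + 3) \notin M -> spoke n (l + 4) \notin M.
  move=> s3; have [i il] := ord_mod n_gt2 l; have := noz i; rewrite negb_and negbK.
  by rewrite !(spoke_mod n_gt2 (mod_add _ il)) (negPf s3).
apply: contraT => sk.
(* Starting from [k + n] makes the subtraction of 3 below exact. *)
have down d : spoke n (k + n + d) \notin M.
  elim: d => [|d IHd]; first by rewrite addn0 (spoke_mod n_gt2 (modnDr _ _)).
  have e3 : k + n + d = (k + n + d - 3) + 3 by lia.
  have -> : k + n + d.+1 = (k + n + d - 3) + 4 by lia.
  by apply: step; rewrite -e3.
(* This distance leads to the index [(k + 1) * n + i0], congruent to [i0]. *)
have := down (k * n - k + i0).
rewrite (spoke_mod n_gt2 (l := i0)) ?si0 //.
have -> : k + n + (k * n - k + i0) = (k + 1) * n + i0.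
  have : k <= k * n by rewrite leq_pmulr; lia.
  lia.
by rewrite modnMDl.
Qed.

(** Without spokes, membership alternates along [uu n k], [uu n (k + 2)] and along [vv n k],
    [vv n (k + 1)]. Hence the pattern next to the spoke at [a + 1] recurs every four indices of the
    gap. *)
Lemma gap_period M a D : perfect_matching (P_edges n) M ->
  spoke n (a + 1) \in M ->
  (forall d, 0 < d < D -> spoke n (a + 1 + d) \notin M) ->
  forall s, 4 * s < D ->
  [/\ (uu n (a + 4 * s) \in M) = (uu n a \in M),
      uu n (a + 4 * s + 1) \notin M & vv n (a + 4 * s + 1) \notin M].
Proof.
move=> pM s1 gap; elim=> [|s IHs] ltD.
  by rewrite muln0 addn0; split=> //; [apply: spoke_uu|apply: spoke_vv].
have {IHs} [|xs xs1 ys1] := IHs; first lia.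
have {ltD} gap' d : 2 <= d <= 5 -> spoke n (a + 4 * s + d) \notin M.
  move=> d25; have -> : a + 4 * s + d = a + 1 + (4 * s + d - 1) by lia.
  by apply: gap; lia.
have -> : a + 4 * s.+1 = a + 4 * s + 4 by lia.
move: xs xs1 ys1 gap'; move: (a + 4 * s) => b <- xb1 yb1 gap'.
have Dx k d : 0 <= d <= 3 -> k = b + d ->
    (uu n (k + 2) \in M) = (uu n k \notin M).
  move=> d03 dk; have := u_cover n_gt2 pM k.
  have -> : (spoke n (k + 2) \in M) = false.
    by apply/negbTE; rewrite dk -addnA gap' //; lia.
  by have := @uu_uu n n_gt2 M pM n4 k; case: (uu n k \in M) => //= [/(_ isT)/negPf|_];
    case: (uu n (k + 2) \in M).
have Dy k d : 1 <= d <= 4 -> k = b + d ->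
    (vv n (k + 1) \in M) = (vv n k \notin M).
  move=> d03 dk; have := v_cover n_gt2 pM k.
  have -> : (spoke n (k + 1) \in M) = false.
    by apply/negbTE; rewrite dk -addnA gap' //; lia.
  by have := @vv_vv n n_gt2 M pM k; case: (vv n k \in M) => //= [/(_ isT)/negPf|_];
    case: (vv n (k + 1) \in M).
split.
- have -> : b + 4 = b + 2 + 2 by lia.
  by rewrite (Dx _ 2) // (Dx _ 0) ?addn0 // negbK.
- have -> : b + 4 + 1 = b + 1 + 2 + 2 by lia.
  have e3 : b + 1 + 2 = b + 3 by lia.
  by rewrite (Dx _ 3 isT e3) (Dx _ 1 isT erefl) !negbK.
- have -> : b + 4 + 1 = b + 1 + 1 + 1 + 1 + 1 by lia.
  have e2 : b + 1 + 1 = b + 2 by lia.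
  have e3 : b + 1 + 1 + 1 = b + 3 by lia.
  have e4 : b + 1 + 1 + 1 + 1 = b + 4 by lia.
  by rewrite (Dy _ 4 isT e4) (Dy _ 3 isT e3) (Dy _ 2 isT e2) (Dy _ 1 isT erefl) !negbK.
Qed.

Lemma even_M1_spokes M : even_matching M -> M1_spokes M.
Proof.
case=> pM [k sk] eM; split.
  by have [i ik] := ord_mod n_gt2 k; exists i; rewrite (spoke_mod n_gt2 ik).
move=> i j [lt_in /andP[lt_ij le_j] si sj gap].
(* The predecessor of [i] modulo [n], also valid when [i = 0]. *)
pose a := i + n - 1.
have shift d : spoke n (a + 1 + d) = spoke n (i + d).
  by apply: spoke_mod => //; rewrite (_ : a + 1 + d = n + (i + d)) ?modnDl // /a; lia.
have sa : spoke n (a + 1) \in M by rewrite -[a + 1]addn0 shift addn0.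
have gapa d : 0 < d < j - i -> spoke n (a + 1 + d) \notin M.
  by move=> dji; rewrite shift gap //; lia.
pose s := (j - i - 1) %/ 4; pose r := (j - i - 1) %% 4.
have Dji : j - i - 1 = 4 * s + r by rewrite mulnC -divn_eq.
have r4 : r < 4 by rewrite ltn_mod.
have [|] := gap_period pM sa gapa (s := s); first lia.
rewrite (negPf (eM a sa)) => /negbT x0 x1 y1.
have Dab d : a + 1 + (4 * s + d) = a + 4 * s + (d + 1) by lia.
have : spoke n (a + 4 * s + (r + 2)) \in M.
  by rewrite (_ : _ + _ = a + 1 + (4 * s + r + 1)) ?shift;
    [rewrite (_ : i + _ = j) //; lia|lia].
have {gapa} gapa d : 0 < d < r + 1 -> spoke n (a + 4 * s + (d + 1)) \notin M.
  by move=> dr; rewrite -Dab gapa //; lia.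
rewrite Dji; move: x0 x1 y1 gapa; move: (a + 4 * s) => b x0 x1 y1 gapa.
(* For [r] equal to 1, 2 or 3, the next spoke at [b + r + 2] leaves [v n (b + 2)], [u n (b + 2)] or
   [u n (b + 3)], respectively, without a matching edge. *)
move: r4 gapa; rewrite -/r; case: (r) => [|[|[|[|//]]]] _ gapa sr.
- by rewrite addn0 modnMr mod0n.
- have := v_cover n_gt2 pM (b + 1); rewrite (negPf y1) -addnA (negPf (gapa 1 _)) // orbF.
  by rewrite (negPf (spoke_vv1 n_gt2 pM _)) // -addnA.
- have := u_cover n_gt2 pM b; rewrite (negPf x0) (negPf (gapa 1 _)) // orbF.
  by rewrite (negPf (spoke_uu2 n_gt2 pM _)) // -addnA.
- have := u_cover n_gt2 pM (b + 1); rewrite (negPf x1) -addnA (negPf (gapa 2 _)) // orbF.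
  by rewrite (negPf (spoke_uu2 n_gt2 pM _)) // -addnA.
Qed.

(** The gap length is a multiple of 4, so periodicity carries [uu n a] to the [uu] edge that ends at
    the next spoke, which excludes it. *)
Lemma M1_spokes_even M : perfect_matching (P_edges n) M -> M1_spokes M ->
  even_matching M.
Proof.
move=> pM [[i0 si0] gap4]; split=> //; first by exists i0.
move=> a sa; have [i ia] := ord_mod n_gt2 (a + 1).
have shift d : spoke n (a + 1 + d) = spoke n (i + d).
  by apply: spoke_mod => //; apply/esym/mod_add.
(* A full turn [n] is a candidate, and is the minimum when there is only one spoke. *)
have ex_j : exists d, (0 < d) && (spoke n (i + d) \in M).
  exists n; rewrite (leq_trans _ n_gt2) //= (spoke_mod n_gt2 (modnDr _ _)).
  by rewrite (spoke_mod n_gt2 ia).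
case: (ex_minnP ex_j) => D /andP[D0 sD] minD.
have leDn : D <= n.
  apply: minD; rewrite (leq_trans _ n_gt2) //= (spoke_mod n_gt2 (modnDr _ _)).
  by rewrite (spoke_mod n_gt2 ia).
have gap d : 0 < d < D -> spoke n (i + d) \notin M.
  by case/andP=> d0 ltd; apply/negP => sd; have := minD d; rewrite d0 sd; lia.
have cons : consecutive_spokes M i (i + D).
  split=> //; first lia.
    by rewrite (spoke_mod n_gt2 ia).
  move=> k ikD; have -> : k = i + (k - i) by lia.
  by apply: gap; lia.
have := gap4 _ _ cons; rewrite mod0n => D4.
pose s := (D - 1) %/ 4.
have DD : D = 4 * s + 1 by have := divn_eq (i + D - i - 1) 4; rewrite D4 addKn /s; lia.
have [||<- _ _] := @gap_period M a D pM sa _ s; [|lia|].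
  by move=> d dD; rewrite shift gap.
apply: (spoke_uu2 n_gt2 pM); rewrite (_ : _ + 2 = a + 1 + D) ?shift //; lia.
Qed.

End EvenMatchings.

(** * Bounds when 4 divides n: all spokes, and no spoke *)

Section NoSpoke.
Variable n : nat.
Hypotheses (n_gt2 : 2 < n) (n_dvd4 : 4 %| n).
Implicit Types (k l p : nat) (M N : {set {set vertex n}}).

Lemma quarterK : 4 * (n %/ 4) = n.
Proof. by rewrite mulnC divnK. Qed.

Lemma forcing_number_all_spokes_le :
  forcing_number (P_edges n) (all_spokes n) <= n %/ 4.
Proof.
(* Every fourth spoke: consecutive ones force the three between, and the last block closes at spoke
   0. *)
pose S := [set spoke n (4 * k) | k : 'I_(n %/ 4)].
have cS : #|S| <= n %/ 4 by rewrite (leq_trans (leq_imset_card _ _)) ?card_ord.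
apply: leq_trans (forcing_number_le (S := S) _) cS; apply/forcing_setP; split.
  by apply/subsetP=> _ /imsetP[k _ ->]; apply: spoke_all_spokes.
move=> N pN /subsetP SN; apply: spokes_all => // k.
have sN q : q < n %/ 4 -> spoke n (4 * q) \in N.
  by move=> ltq; apply/SN/imsetP; exists (Ordinal ltq).
have ltk : k %% n < n by rewrite ltn_mod ltnW // ltnW.
rewrite -(spoke_mod n_gt2 (modn_mod k n)) (divn_eq (k %% n) 4) mulnC.
have : (k %% n) %/ 4 < n %/ 4 by rewrite ltn_divLR // divnK.
have : (k %% n) %% 4 < 4 by rewrite ltn_mod.
move: (_ %% 4) (_ %/ 4) => r q r4 ltq.
have s4 : spoke n (4 * q + 4) \in N.
  have -> : 4 * q + 4 = 4 * q.+1 by lia.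
  have [/sN //|leq4] := ltnP q.+1 (n %/ 4).
  have -> : q.+1 = n %/ 4 by lia.
  rewrite quarterK (spoke_mod n_gt2 (l := 4 * 0)) ?sN //; first by lia.
  by rewrite modnn mod0n.
have := spokes4_forced n_gt2 pN (sN q ltq) s4; rewrite spokes4_sub.
by case/and4P=> s0 s1 s2 s3; case: r r4 => [|[|[|[|//]]]] _; rewrite ?addn0.
Qed.

Lemma disjoint_spokes4_quarters i (k l : 'I_(n %/ 4)) : k != l ->
  [disjoint spokes4 n (i + 4 * k) & spokes4 n (i + 4 * l)].
Proof.
apply: contraNT; rewrite -setI_eq0 => /set0Pn[e /setIP[ek el]].
have spokes4P p : e \in spokes4 n p -> exists2 r, r < 4 & e = spoke n (p + r).
  rewrite !inE -!orbA => /or4P[] /eqP ->; [exists 0|exists 1|exists 2|exists 3] => //.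
  by rewrite addn0.
have [r r4 er] := spokes4P _ ek; have [s s4 es] := spokes4P _ el.
have := spoke_inj n_gt2 (etrans (esym er) es); rewrite -!addnA => /eqP.
have := quarterK; have := ltn_ord k; have := ltn_ord l => ltl ltk eqn.
rewrite eqn_modDl !modn_small; [|lia|lia].
by move/eqP=> kl; apply/eqP/val_inj => /=; lia.
Qed.

(** A common edge would have a vertex covered by both of the corresponding blocks of spokes, which
    are disjoint parts of one matching. *)
Lemma disjoint_zigzag_quarters i (k l : 'I_(n %/ 4)) : k != l ->
  [disjoint zigzag n (i + 4 * k) & zigzag n (i + 4 * l)].
Proof.
move=> kl; have pZ := all_spokes_perfect n_gt2; have /and3P[_ tZ _] := pZ.
have sZ p : spokes4 n p \subset all_spokes n.
  by rewrite spokes4_sub !spoke_all_spokes.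
rewrite -setI_eq0; apply: contraT => /set0Pn[e /setIP[ek el]].
have [x xe] : exists x, x \in e.
  apply/set0Pn; apply: contraNneq (P_edges_nonempty n_gt2) => <-.
  have : zigzag n (i + 4 * k) \subset P_edges n by rewrite zigzag_sub !uu_edge ?vv_edge.
  by move/subsetP/(_ e ek).
have [d dk xd] : exists2 d, d \in spokes4 n (i + 4 * k) & x \in d.
  by apply/bigcupP; rewrite -/(cover _) -cover_zigzag; apply/bigcupP; exists e.
have : x \in cover (spokes4 n (i + 4 * l)).
  by rewrite -cover_zigzag; apply/bigcupP; exists e.
rewrite (sub_coverE tZ (sZ _) (subsetP (sZ _) _ dk) xd).
by rewrite (disjointFr (disjoint_spokes4_quarters i kl) dk).
Qed.

Section Bounds.
Variable M : {set {set vertex n}}.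
Hypotheses (n4 : n != 4) (pM : perfect_matching (P_edges n) M).
Variable i : nat.
Hypothesis defM : M = \bigcup_(k < n %/ 4) zigzag n (i + 4 * k).

Let zM (k : 'I_(n %/ 4)) : zigzag n (i + 4 * k) \subset M.
Proof. by rewrite defM (bigcup_sup k). Qed.

Lemma forcing_number_no_spoke_ge : n %/ 4 <= forcing_number (P_edges n) M.
Proof.
pose F (k : 'I_(n %/ 4)) := zigzag n (i + 4 * k).
apply: (@forcing_number_ge _ _ (P_edges_nonempty n_gt2) _ _ F) => //.
- by move=> S k; apply: forcing_set_meets_zigzag.
- by move=> k l; apply: disjoint_zigzag_quarters.
Qed.

Lemma forcing_number_all_spokes_ge :
  n %/ 4 <= forcing_number (P_edges n) (all_spokes n).
Proof.
have pZ := all_spokes_perfect n_gt2.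
pose F (k : 'I_(n %/ 4)) := spokes4 n (i + 4 * k).
apply: (@forcing_number_ge _ _ (P_edges_nonempty n_gt2) _ _ F) => //.
(* Each block of spokes can be exchanged for the zigzag of [M] on the same indices. *)
- move=> S k; apply: forcing_set_meets_spokes4 => //.
    exact: pM.
  by rewrite spokes4_sub !spoke_all_spokes.
- by move=> k l; apply: disjoint_spokes4_quarters.
Qed.

Lemma forcing_number_no_spoke_le :
  forcing_number (P_edges n) M <= (n %/ 4).+1.
Proof.
have m2 : 1 < n %/ 4 by have := quarterK; lia.
(* The two [uu] edges start the chain of zigzags, and one [vv] edge for each block but the first
   carries it on. *)
pose S := [set uu n i; uu n (i + 1)] :|:
  [set vv n (i + 4 * k.+1) | k : 'I_(n %/ 4).-1].
have cS : #|S| <= (n %/ 4).+1.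
  apply: leq_trans (leq_card_setU _ _) _.
  have -> : (n %/ 4).+1 = 2 + (n %/ 4).-1 by lia.
  apply: leq_add; first by rewrite cards2; case: (_ != _).
  by rewrite (leq_trans (leq_imset_card _ _)) ?card_ord.
apply: leq_trans (forcing_number_le (S := S) _) cS; apply/forcing_setP; split.
  apply/subsetP=> e /setUP[|/imsetP[k _ ->]].
    have lt0 : 0 < n %/ 4 by lia.
    have := zM (Ordinal lt0); rewrite /= muln0 addn0 zigzag_sub.
    by case/and4P=> x0 x1 _ _; rewrite !inE => /orP[] /eqP ->.
  have ltk : k.+1 < n %/ 4 by have := ltn_ord k; lia.
  by have := zM (Ordinal ltk); rewrite zigzag_sub => /and4P[].
move=> N pN; rewrite !subUset !sub1set => /andP[/andP[x0 x1] /subsetP SN].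
have y k : 0 < k < n %/ 4 -> vv n (i + 4 * k) \in N.
  case: k => // k ltk; have ltk' : k < (n %/ 4).-1 by lia.
  by apply/SN/imsetP; exists (Ordinal ltk').
(* There are at least two blocks, so [S] contains [vv n (i + 4)]. The first link of the chain then
   gives the missing edge [vv n i], which closes the last block. *)
have y0 : vv n i \in N.
  have [|z _ _] := zigzag_chain n_gt2 pN n4 x0 x1 _; first by apply: (y 1).
  by move: z; rewrite zigzag_sub => /and4P[].
have yS k : k < n %/ 4 -> vv n (i + 4 * k + 4) \in N.
  move=> ltk; have -> : i + 4 * k + 4 = i + 4 * k.+1 by lia.
  have [ltk1|lek] := ltnP k.+1 (n %/ 4); first by apply: y.
  have -> : k.+1 = n %/ 4 by lia.
  by rewrite quarterK (vv_mod n_gt2 (modnDr _ _)).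
have x k : k < n %/ 4 -> uu n (i + 4 * k) \in N /\ uu n (i + 4 * k + 1) \in N.
  elim: k => [|k IHk] ltk; first by rewrite muln0 addn0.
  have [xk xk1] := IHk (ltnW ltk).
  have [] := zigzag_chain n_gt2 pN n4 xk xk1 (yS k (ltnW ltk)).
  have -> : i + 4 * k.+1 = i + 4 * k + 4 by lia.
  by rewrite -[i + 4 * k + 4 + 1]addnA.
apply: (perfect_matching_sub (P_edges_nonempty n_gt2) pM pN).
rewrite defM; apply/bigcupsP=> k _; have [xk xk1] := x k (ltn_ord k).
by have [] := zigzag_chain n_gt2 pN n4 xk xk1 (yS k (ltn_ord k)).
Qed.

End Bounds.
End NoSpoke.

(** * The case n = 4 *)

Lemma forcing_number_P4 (M : {set {set vertex 4}}) :
  M1 M -> forcing_number (P_edges 4) M <= 1.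
Proof.
rewrite /M1 eqxx => -[] ->; first exact: (@forcing_number_all_spokes_le 4).
have n_gt2 : 2 < 4 by [].
have -> : [set uu 4 0; uu 4 1; vv 4 0; vv 4 2] = zigzag 4 0 by [].
apply: leq_trans (forcing_number_le (S := [set vv 4 0]) _) _; last by rewrite cards1.
apply/forcing_setP; split; first by rewrite sub1set !inE eqxx !orbT.
move=> N pN; rewrite sub1set => y0.
(* Here [u] indices differing by 2 give one edge named twice, so excluding a spoke already forces
   the [uu] edge. *)
have x20 : uu 4 2 = uu 4 0 by rewrite /uu [RHS]setUC (u_mod n_gt2 (l := 0) (k := 2 + 2)).
have x31 : uu 4 3 = uu 4 1 by rewrite /uu [RHS]setUC (u_mod n_gt2 (l := 1) (k := 3 + 2)).
have s0 : spoke 4 0 \notin N by apply: contraL y0; apply: spoke_vv.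
have s1 : spoke 4 1 \notin N by apply: contraL y0; apply: (@spoke_vv1 4 _ _ _ 0).
have y1 : vv 4 1 \notin N by have := vv_vv n_gt2 pN y0.
have x0 : uu 4 0 \in N.
  have := u_cover n_gt2 pN 2; rewrite x20 (spoke_mod n_gt2 (l := 0)) // (negPf s0).
  by rewrite (uu_mod n_gt2 (l := 0)) // orbF orbb.
have x1 : uu 4 1 \in N.
  have := u_cover n_gt2 pN 3; rewrite x31 (spoke_mod n_gt2 (l := 1)) // (negPf s1).
  by rewrite (uu_mod n_gt2 (l := 1)) // orbF orbb.
have s2 : spoke 4 2 \notin N by apply: contraL x0; apply: (@spoke_uu2 4 _ _ _ 0).
have y2 : vv 4 2 \in N.
  by have := v_cover n_gt2 pN 1; rewrite (negPf y1) (negPf s2) orbF.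
apply: (perfect_matching_covered (P_edges_nonempty n_gt2) pN).
  by rewrite zigzag_sub x0 x1 y0 y2.
have /and3P[_ _ /eqP <-] := all_spokes_perfect n_gt2.
rewrite cover_zigzag; congr cover; apply/eqP; rewrite eqEsubset.
rewrite spokes4_sub !spoke_all_spokes //=; apply/subsetP=> _ /imsetP[i _ ->].
by case: i => [[|[|[|[|]]]] //= ?]; rewrite !inE eqxx ?orbT.
Qed.

(** * Interpolation between forcing numbers *)

(** A discrete intermediate value argument, by induction on the number of edges that are not spokes:
    a step of size at most one from [f M], which is not [t], cannot jump over [t]. *)
Lemma even_between n (n_gt2 : 2 < n) (n4 : n != 4) (M : {set {set vertex n}}) t :
  let f := forcing_number (P_edges n) in even_matching M ->
  f M <= t <= f (all_spokes n) \/ f (all_spokes n) <= t <= f M ->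
  M1_forcing_values n t.
Proof.
move=> f; have [m] := ubnP #|M :\: all_spokes n|.
elim: m M => // m IHm M ltm eM btw.
have [eft|neft] := eqVneq (f M) t.
  exists M; split=> //; rewrite /M1 (negPf n4); have [pM _ _] := eM.
  by split=> //; left; apply: even_M1_spokes.
have [MZ|MZ] := eqVneq M (all_spokes n).
  by move: btw neft; rewrite MZ; lia.
have [p [zM sM]] := even_zigzag n_gt2 n4 eM (elimN eqP MZ).
have [pM _ _] := eM.
apply: (IHm (straighten M p)).
- by have := card_straighten n_gt2 zM; lia.
- exact: even_straighten.
- have := forcing_number_straighten_le n_gt2 pM zM sM.
  have := forcing_number_straighten_ge n_gt2 n4 pM zM sM.
  by rewrite -!/(f _); move: btw neft; lia.
Qed.

Lemma M1_between n (n_gt2 : 2 < n) (n4 : n != 4) (M : {set {set vertex n}}) t :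
  let f := forcing_number (P_edges n) in M1 M ->
  f M <= t <= f (all_spokes n) \/ f (all_spokes n) <= t <= f M ->
  M1_forcing_values n t.
Proof.
move=> f M1M; have := M1M; rewrite /M1 (negPf n4) => -[pM [sM|[_ n_dvd4 [i defM]]]].
  by apply: even_between => //; apply: M1_spokes_even.
have := forcing_number_no_spoke_ge n_gt2 n_dvd4 pM defM.
have := forcing_number_no_spoke_le n_gt2 n_dvd4 n4 pM defM.
have := forcing_number_all_spokes_ge n_gt2 n_dvd4 pM defM.
have := forcing_number_all_spokes_le n_gt2 n_dvd4.
rewrite -!/(f _) => fZ_le fZ_ge fM_le fM_ge btw.
(* Here [f (all_spokes n)] is [n %/ 4] and [f M] exceeds it by at most one, so [t] is one of these
   two values. *)
have [eft|neft] := eqVneq (f M) t; first by exists M.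
apply: (even_between n_gt2 n4 (even_all_spokes n_gt2)); rewrite -!/(f _).
by move: btw neft; lia.
Qed.

Theorem theorem3p3 (n : nat) (hn : 3 <= n) :
  continuous_set (M1_forcing_values n).
Proof.
move=> _ t _ [Ma [MaM1 <-]] [Mb [MbM1 <-]] /andP[lt_at lt_tb].
have [n4|n4] := eqVneq n 4.
  subst n; have := forcing_number_P4 MbM1; lia.
(* The value at all spokes is the pivot: [t] lies between it and the value at [Ma], or between it
   and the value at [Mb]. *)
have [le_tZ|lt_Zt] := leqP t (forcing_number (P_edges n) (all_spokes n)).
  by apply: (M1_between hn n4 MaM1); left; rewrite ltnW.
by apply: (M1_between hn n4 MbM1); right; rewrite (ltnW lt_Zt) ltnW.
Qed.
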